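(* Let $k \geq 2$, let $\alpha_1,\ldots,\alpha_k$ be real numbers with $\alpha_k \neq 0$, and let $(a_n)_{n\ge 0}$ be defined by $a_0=a_1=\cdots=a_{k-2}=0$, $a_{k-1}=1$ and $a_n=\alpha_1a_{n-1}+\alpha_2a_{n-2}+\cdots+\alpha_ka_{n-k}$ for $n \geq k$. Assume that $a_n\ge 0$ for all $n$. Let $f(x)=x^k-\alpha_1x^{k-1}-\alpha_2x^{k-2}-\cdots-\alpha_k$, and suppose that $f$ has a dominant zero $\lambda$ such that $f'(\lambda)>1$. Then there exists $N$ (depending on $\alpha_1,\ldots,\alpha_k$) such that the ratio $\frac{\sqrt[n]{a_n}}{\sqrt[n-1]{a_{n-1}}}$ is strictly decreasing for $n\ge N$, i.e. $$\frac{\sqrt[n]{a_n}}{\sqrt[n-1]{a_{n-1}}}>\frac{\sqrt[n+1]{a_{n+1}}}{\sqrt[n]{a_n}}\qquad\text{for all } n\ge N,$$ and moreover $$\lim_{n\to\infty}\frac{\sqrt[n]{a_n}}{\sqrt[n-1]{a_{n-1}}}=1.$$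
   Context: A zero of a polynomial $g$ (among its complex zeros) is called dominant if it is simple and is strictly greater in modulus than all of the other zeros of $g$. (A dominant zero of a polynomial with real coefficients is necessarily real.) For $y\ge 0$ and an integer $n\ge1$, $\sqrt[n]{y}$ denotes the non-negative real $n$-th root. $N\geq 2$ is understood to be such that the ratios in question are defined, i.e. their denominators are nonzero, for $n\ge N$. *)

(* Defs.v *)
From HB Require Import structures.
From mathcomp Require Import all_boot all_order all_algebra.
From mathcomp Require Import complex.
From mathcomp Require Import all_classical all_reals all_analysis.

Set Implicit Arguments.
Unset Strict Implicit.
Unset Printing Implicit Defensive.

Import Order.TTheory GRing.Theory Num.Theory.
Import numFieldNormedType.Exports.

Local Open Scope classical_set_scope.
Local Open Scope ring_scope.

(* Coefficients are indexed from 1: only alpha 1, ..., alpha k are used. *)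
Definition linrec_poly (R : realType) (k : nat) (alpha : nat -> R) : {poly R} :=
  'X^k - \sum_(1 <= i < k.+1) alpha i *: 'X^(k - i).

Definition is_linrec (R : realType) (k : nat) (alpha : nat -> R)
    (a : nat -> R) : Prop :=
  [/\ forall n, (n < k.-1)%N -> a n = 0,
      a k.-1 = 1
    & forall n, (k <= n)%N -> a n = \sum_(1 <= i < k.+1) alpha i * a (n - i)%N].

(* The modulus `|w| is itself an element of R[i]; moduli are real, so their
   comparison in the partial order of R[i] is the usual one.  Similarly 1 < w in
   R[i] says that w is real and greater than 1. *)
Definition dominant_zero (R : realType) (g : {poly R[i]}) (z : R[i]) : Prop :=
  [/\ root g z, mup z g = 1%N
    & forall w : R[i], root g w -> w != z -> `|w| < `|z|].

(* Only meaningful for 0 <= y and 1 <= n. *)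
Definition real_root (R : realType) (n : nat) (y : R) : R := y `^ (n%:R^-1).

Definition root_ratio (R : realType) (a : nat -> R) (n : nat) : R :=
  real_root n (a n) / real_root n.-1 (a n.-1).

(* Main.v *)
Require Import Defs.
From HB Require Import structures.
From mathcomp Require Import all_boot all_order all_algebra.
From mathcomp Require Import complex.
From mathcomp Require Import all_classical all_reals all_analysis.
From mathcomp Require Import ring lra.

(** The characteristic polynomial factors as f = (X - z) g with z = lambda, and
    g(z) = f'(z) =: D.  Let polynomials act on sequences, X acting as the
    shift.  Since f annihilates a, the sequence g.a is geometric of ratio z,
    and its first value is a_(k-1) = 1 because g is monic of degree k-1; thus
    g.a = (z^n)_n, which is also g.(z^n / D)_n.  The difference a_n - z^n / D
    is therefore annihilated by g, all of whose zeros are smaller than some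
    r < |z| in modulus, and so it is O(r^n)
    ([simple_dominant_asymptotics]).  Working with this explicit particular
    solution gives the leading constant 1/D without any partial fractions.

    As a_n is nonnegative and D positive, the powers z^n are O(r^n)-close to
    |z|^n, which forces z = |z| =: l ([nonneg_geometric_base]).

    Consequently ln a_n = n ln l - ln D + e_n with e_n exponentially small, so
    ln(a_n)/n = ln l + (e_n - ln D)/n.  The logarithm of the root ratio is the
    first difference of this sequence.  It tends to 0; it eventually decreases
    because the second difference of -(ln D)/n is of order -2 (ln D)/n^3, with
    ln D > 0 by the hypothesis D > 1, and this dominates the contribution of
    e_n ([second_difference_lt0], [root_ratio_asymptotics]). *)

Set Implicit Arguments.
Unset Strict Implicit.
Unset Printing Implicit Defensive.

Import Order.TTheory GRing.Theory Num.Theory.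
Import numFieldNormedType.Exports.

Local Open Scope classical_set_scope.
Local Open Scope ring_scope.

(** * Polynomials acting on sequences by shifts *)

Definition shift_op (S : comNzRingType) (u : nat -> S) (n : nat) (p : {poly S})
  : S := \sum_(j < size p) p`_j * u (n + j)%N.

(** Sums of polynomials of different sizes become comparable after a common
    widening of the summation range. *)
Lemma shift_op_widen (S : comNzRingType) (u : nat -> S) n m (p : {poly S}) :
  (size p <= m)%N -> shift_op u n p = \sum_(j < m) p`_j * u (n + j)%N.
Proof.
move=> le_pm; rewrite /shift_op (big_ord_widen m (fun j => p`_j * u (n + j)%N))//.
rewrite big_mkcond; apply: eq_bigr => j _.
by case: ltnP => // le_pj; rewrite nth_default// mul0r.
Qed.

Lemma shift_op_is_linear (S : comNzRingType) (u : nat -> S) n :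
  linear_for *%R (shift_op u n).
Proof.
move=> c p q; pose m := maxn (size p) (size q).
rewrite (shift_op_widen _ _ (leq_maxl _ (size q) : size p <= m)%N).
rewrite (shift_op_widen _ _ (leq_maxr (size p) _ : size q <= m)%N).
rewrite (@shift_op_widen _ _ _ m); last first.
  rewrite (leq_trans (size_polyD _ _))// geq_max leq_maxr andbT.
  by rewrite (leq_trans (size_scale_leq _ _))// leq_maxl.
rewrite mulr_sumr -big_split; apply: eq_bigr => j _ /=.
by rewrite coefD coefZ mulrDl mulrA.
Qed.

HB.instance Definition _ (S : comNzRingType) (u : nat -> S) n :=
  GRing.isSemilinear.Build S {poly S} S *%R (shift_op u n)
    (GRing.semilinear_linear (shift_op_is_linear u n)).

Lemma shift_opXn (S : comNzRingType) (u : nat -> S) n m :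
  shift_op u n 'X^m = u (n + m)%N.
Proof.
rewrite /shift_op size_polyXn big_ord_recr/= coefXn eqxx mul1r big1 ?add0r//.
by move=> j _; rewrite coefXn ltn_eqF ?mul0r.
Qed.

Lemma shift_opMXsubC (S : comNzRingType) (u : nat -> S) n (p : {poly S}) z :
  shift_op u n (p * ('X - z%:P)) = shift_op u n.+1 p - z * shift_op u n p.
Proof.
rewrite mulrBr mulrC [p * z%:P]mulrC mul_polyC linearB linearZ/=; congr (_ - _).
rewrite (@shift_op_widen _ _ _ (size p).+1); last first.
  by rewrite (leq_trans (size_polyMleq _ _))// size_polyX.
rewrite big_ord_recl coefXM/= mul0r add0r; apply: eq_bigr => j _.
by rewrite coefXM/= addSnnS.
Qed.

Lemma shift_op_geometric (S : comNzRingType) (z c : S) n (p : {poly S}) :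
  shift_op (fun m => z ^+ m * c) n p = z ^+ n * c * p.[z].
Proof.
rewrite /shift_op horner_coef mulr_sumr; apply: eq_bigr => j _.
by rewrite exprD; ring.
Qed.

Lemma shift_opB_seq (S : comNzRingType) (u v : nat -> S) n (p : {poly S}) :
  shift_op (fun m => u m - v m) n p = shift_op u n p - shift_op v n p.
Proof.
by rewrite /shift_op -sumrB; apply: eq_bigr => j _; rewrite mulrBr.
Qed.

(** * Growth of solutions of linear recurrences *)

Lemma exists_radius (S : numFieldType) (p : S) (s : seq S) : 0 < p ->
  (forall z, z \in s -> `|z| < p) ->
  exists r, [/\ 0 < r, r < p & forall z, z \in s -> `|z| < r].
Proof.
move=> p0; elim: s => [_|z s IH sp].
  by exists (p / 2); rewrite divr_gt0// gtr_pMr// invf_lt1// ltr1n.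
have [|r [r0 rp rs]] := IH; first by move=> w ws; rewrite sp// inE ws orbT.
have zp : `|z| < p by rewrite sp// mem_head.
have [zr|rz] := real_ltP (normr_real z) (gtr0_real r0).
  by exists r; split=> // w; rewrite inE => /predU1P[->|/rs].
exists ((`|z| + p) / 2); have [z1 z2] := midf_lt zp; split=> //.
  by rewrite (le_lt_trans (normr_ge0 z)).
move=> w; rewrite inE => /predU1P[->//|/rs wr].
exact: lt_trans (lt_le_trans wr rz) z1.
Qed.

(** The bound B' = |v 0| + B / (r - |z|) propagates along
    v (n+1) = z v n + O(r^n), because |z| B' + B <= r B'. *)
Lemma first_order_growth (S : numFieldType) (v : nat -> S) z r B : 0 < r ->
  `|z| < r -> (forall n, `|v n.+1 - z * v n| <= B * r ^+ n) ->
  exists B', forall n, `|v n| <= B' * r ^+ n.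
Proof.
move=> r0 zr vB; exists (`|v 0%N| + B / (r - `|z|)).
have B0 : 0 <= B by have := vB 0%N; rewrite expr0 mulr1; exact: le_trans.
have rz0 : 0 < r - `|z| by rewrite subr_gt0.
elim=> [|n IH]; first by rewrite expr0 mulr1 lerDl divr_ge0// ltW.
have -> : v n.+1 = (v n.+1 - z * v n) + z * v n by rewrite subrK.
rewrite (le_trans (ler_normD _ _))// normrM.
rewrite (le_trans (lerD (vB n) (ler_wpM2l (normr_ge0 _) IH)))//.
set B' := _ + B / _.
have BB' : B <= B' * (r - `|z|).
  by rewrite mulrDl divfK ?gt_eqF// lerDr mulr_ge0// ltW.
have := ler_wpM2r (exprn_ge0 n (ltW r0)) BB'; rewrite -subr_ge0 => H.
rewrite -subr_ge0; apply: le_trans H _; rewrite le_eqVlt; apply/orP; left.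
by apply/eqP; rewrite exprS; ring.
Qed.

(** Peeling off one linear factor at a time reduces the claim to first-order
    recurrences.  The same radius serves for every factor, so multiple zeros
    cost nothing: r strictly exceeds all of their moduli. *)
Lemma shift_op_growth (S : numFieldType) (u : nat -> S) (s : seq S) r B :
  0 < r -> (forall z, z \in s -> `|z| < r) ->
  (forall n, `|shift_op u n (\prod_(z <- s) ('X - z%:P))| <= B * r ^+ n) ->
  exists B', forall n, `|u n| <= B' * r ^+ n.
Proof.
move=> r0; elim: s B => [|z s IH] B sr uB.
  exists B => n; have := uB n.
  by rewrite big_nil -(expr0 'X) shift_opXn addn0.
have [B' vB'] : exists B', forall n,
    `|shift_op u n (\prod_(w <- s) ('X - w%:P))| <= B' * r ^+ n.
  apply: (@first_order_growth _ _ z r B) => [//||n]; first by rewrite sr ?mem_head.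
  by have := uB n; rewrite big_cons mulrC shift_opMXsubC.
by apply: (IH B') => // w ws; rewrite sr// inE ws orbT.
Qed.

(** With f = g (X - z), both u and z^n / g(z) are mapped by g to z^n, so their
    difference is killed by g, whose zeros lie strictly inside the circle of
    radius |z|. *)
Lemma simple_dominant_asymptotics (S : numClosedFieldType) (u : nat -> S)
    (f : {poly S}) (z : S) :
  f \is monic -> root f z -> 0 < `|z| -> f^`().[z] != 0 ->
  (forall w, root f w -> w != z -> `|w| < `|z|) ->
  (forall n, shift_op u n f = 0) ->
  (forall n, (n < (size f).-2)%N -> u n = 0) -> u (size f).-2 = 1 ->
  exists r B, [/\ 0 < r, r < `|z|
    & forall n, `|u n - z ^+ n / f^`().[z]| <= B * r ^+ n].
Proof.
move=> fmon /factor_theorem[g fE] z0 f'z zdom uf u0 u1.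
have gmon : g \is monic.
  by move: fmon; rewrite !monicE fE lead_coef_Mmonic// monicXsubC.
have gn0 := monic_neq0 gmon.
have szg : (size f).-2 = (size g).-1.
  by rewrite fE size_Mmonic// ?monicXsubC// size_XsubC addn2.
have gz : f^`().[z] = g.[z].
  by rewrite fE derivM derivXsubC mulr1 hornerD hornerM hornerXsubC subrr mulr0 add0r.
rewrite gz in f'z *.
have ug n : shift_op u n g = z ^+ n.
  elim: n => [|n IH]; last first.
    have := uf n; rewrite fE shift_opMXsubC IH -exprS => /eqP.
    by rewrite subr_eq0 => /eqP.
  (* Only the leading term survives: u vanishes below the degree of g. *)
  rewrite /shift_op expr0 -(prednK (_ : 0 < size g)%N) ?size_poly_gt0//.
  rewrite big_ord_recr/= big1 ?add0r => [|j _]; last first.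
    by rewrite u0 ?mulr0// szg; exact: ltn_ord.
  rewrite add0n -szg u1 mulr1 szg. exact: (monicP gmon).
have [s sE] := closed_field_poly_normal g.
rewrite (monicP gmon) scale1r in sE.
have [|r [r0 rz rs]] := @exists_radius _ `|z| s z0.
  move=> w ws; have gw : root g w by rewrite sE root_prod_XsubC.
  apply: zdom; first by rewrite fE rootM gw.
  by apply: contraNneq f'z => <-; rewrite -[_ == 0]/(root g w).
have [|B uB] := @shift_op_growth S (fun n => u n - z ^+ n / g.[z]) s r 0 r0 rs.
  move=> n; rewrite -sE shift_opB_seq shift_op_geometric ug mulfVK// subrr.
  by rewrite normr0 mul0r.
by exists r, B.
Qed.

(** * Logarithmic estimates *)

(** Writing q = exp(-c), this is the Taylor bound (c n)^3 / 6 <= exp(c n). *)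
Lemma geometric_cube_decay (R : realType) (q : R) : 0 < q -> q < 1 ->
  exists2 K, 0 < K & forall n : nat, n%:R ^+ 3 * q ^+ n <= K.
Proof.
move=> q0 q1; pose c := - ln q.
have c0 : 0 < c by rewrite oppr_gt0 ln_lt0// q0.
have qE : q = expR (- c) by rewrite opprK lnK.
exists (6 / c ^+ 3) => [|n]; first by rewrite divr_gt0// exprn_gt0.
have := @expR_ge1Dxn R (c * n%:R) 2 (mulr_ge0 (ltW c0) (ler0n _ n)).
have -> : 3`!%:R = 6 :> R by [].
move=> H.
have {}H : (c * n%:R) ^+ 3 / 6 <= expR (c * n%:R) by lra.
rewrite ler_pdivlMr ?exprn_gt0// qE -expRM_natr mulNr.
have E0 := expR_gt0 (c * n%:R).
rewrite expRN mulrAC ler_pdivrMr//; move: H; rewrite exprMn; lra.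
Qed.

(** The terms in T contribute -2 T / (x (x + 1) (x + 2)) to the second
    difference.  The cubic decay of the e's bounds their contribution, times
    that denominator, by 9 K / x. *)
Lemma second_difference_lt0 (R : realFieldType) (x T K e0 e1 e2 : R) :
  1 <= x -> 9 * K < 2 * T * x ->
  x ^+ 3 * `|e0| <= K -> (x + 1) ^+ 3 * `|e1| <= K ->
  (x + 2) ^+ 3 * `|e2| <= K ->
  (e2 - T) / (x + 2) - (e1 - T) / (x + 1) < (e1 - T) / (x + 1) - (e0 - T) / x.
Proof.
move=> x1 KT h0 h1 h2.
have x0 : 0 < x by lra.
have b0 : x * ((x + 1) * (x + 2)) * `|e0| <= 6 * K.
  apply: le_trans (_ : 6 * (x ^+ 3 * `|e0|) <= _); last by lra.
  rewrite [leRHS]mulrA ler_wpM2r//; nra.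
have b1 : x * (2 * (x * (x + 2))) * `|e1| <= 2 * K.
  apply: le_trans (_ : 2 * ((x + 1) ^+ 3 * `|e1|) <= _); last by lra.
  rewrite [leRHS]mulrA ler_wpM2r//; nra.
have b2 : x * (x * (x + 1)) * `|e2| <= K.
  apply: le_trans h2; rewrite ler_wpM2r//; nra.
have n0 := ler_norm e0; have n1 := ler_norm (- e1); have n2 := ler_norm e2.
rewrite normrN in n1.
have p0 : 0 <= x * ((x + 1) * (x + 2)) by nra.
have p1 : 0 <= x * (2 * (x * (x + 2))) by nra.
have p2 : 0 <= x * (x * (x + 1)) by nra.
have {}n0 := le_trans (ler_wpM2l p0 n0) b0.
have {}n1 := le_trans (ler_wpM2l p1 n1) b1.
have {}n2 := le_trans (ler_wpM2l p2 n2) b2.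
rewrite -subr_lt0.
have -> : (e2 - T) / (x + 2) - (e1 - T) / (x + 1)
    - ((e1 - T) / (x + 1) - (e0 - T) / x)
  = (x * ((x + 1) * (x + 2)) * e0 + x * (2 * (x * (x + 2))) * - e1
     + x * (x * (x + 1)) * e2 - 2 * T * x) / (x ^+ 2 * (x + 1) * (x + 2)).
  (* The extra factor x brings the bounds b0, b1 and b2 into the numerator. *)
  by field; rewrite !gt_eqF//; lra.
rewrite pmulr_llt0 ?invr_gt0 ?mulr_gt0 ?exprn_gt0//; lra.
Qed.

(** The lower bound is ln y <= y - 1 applied to y = 1 / (1 + x). *)
Lemma ln1D_bound (R : realType) (x : R) : `|x| <= 2^-1 -> `|ln (1 + x)| <= 2 * `|x|.
Proof.
move=> xle; have [xl xr] : - 2^-1 <= x /\ x <= 2^-1 by apply/andP; rewrite -ler_norml.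
have h1 : ln (1 + x) <= x by apply: le_ln1Dx; lra.
have x0 : 0 < 1 + x by lra.
have h2 : - ln (1 + x) <= (1 + x)^-1 - 1.
  rewrite -lnV ?posrE// -[X in ln X](subrK 1) addrC le_ln1Dx// ltrBrDl subrr.
  by rewrite invr_gt0.
have h3 : (1 + x)^-1 - 1 = - x / (1 + x) by field; lra.
rewrite ler_norml; have := ler_norm x; have := ler_norm (- x); rewrite normrN.
move=> n1 n2; apply/andP; split; last by lra.
rewrite lerNl (le_trans h2)// h3 ler_pdivrMr//; have := normr_ge0 x; nra.
Qed.

(** The relative error x n = a n D / l^n - 1 is O((r / l)^n), and
    e n = ln (1 + x n) inherits this decay; only its cubic consequence is
    recorded, that being what the second difference calls for. *)
Lemma ln_asymptotics (R : realType) (a : nat -> R) (l r D B : R) :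
  0 < r -> r < l -> 0 < D ->
  (forall n, `|a n - l ^+ n / D| <= B * r ^+ n) ->
  exists (K : R) (e : nat -> R), 0 < K /\
    \forall n \near \oo, [/\ 0 < a n, ln (a n) = ln l *+ n + (e n - ln D)
      & n%:R ^+ 3 * `|e n| <= K].
Proof.
move=> r0 rl D0 aB; have l0 := lt_trans r0 rl.
have B0 : 0 <= B by have := aB 0%N; rewrite expr0 mulr1; exact: le_trans.
pose q := r / l.
have q0 : 0 < q by rewrite divr_gt0.
have q1 : q < 1 by rewrite ltr_pdivrMr// mul1r.
have [K K0 Kq] := geometric_cube_decay q0 q1.
pose x n := a n * D / l ^+ n - 1.
have xB n : `|x n| <= B * D * q ^+ n.
  have ln0 : 0 < l ^+ n by rewrite exprn_gt0.
  have -> : x n = (a n - l ^+ n / D) * (D / l ^+ n).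
    by rewrite /x; field; rewrite !gt_eqF.
  rewrite normrM (gtr0_norm (divr_gt0 D0 ln0)) expr_div_n.
  rewrite (le_trans (ler_wpM2r (ltW (divr_gt0 D0 ln0)) (aB n)))//.
  by rewrite le_eqVlt; apply/orP; left; apply/eqP; field; rewrite gt_eqF.
exists (2 * (B * D) * K + 1), (fun n => ln (1 + x n)); split.
  by rewrite ltr_wpDl// !mulr_ge0// ltW.
have small : \forall n \near \oo, B * D * q ^+ n <= 2^-1.
  have : (B * D) * q ^+ n @[n --> \oo] --> (B * D) * 0.
    by apply: cvgMr; apply: cvg_expr; rewrite gtr0_norm.
  rewrite mulr0 => /cvgr0_norm_le /(_ 2^-1)[|N _ HN]; first by rewrite invr_gt0.
  by exists N => // n /HN /=; apply: le_trans; exact: ler_norm.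
near=> n.
have xs : `|x n| <= 2^-1 by rewrite (le_trans (xB n))//; near: n.
have ln0 : 0 < l ^+ n by rewrite exprn_gt0.
have x1 : 0 < 1 + x n by have := ler_norm (- x n); rewrite normrN; lra.
have aE : a n = l ^+ n * ((1 + x n) / D).
  by rewrite /x; field; rewrite !gt_eqF.
split.
- by rewrite aE mulr_gt0// divr_gt0.
- by rewrite aE lnM ?posrE ?divr_gt0// lnXn// ln_div ?posrE.
- rewrite (le_trans (ler_wpM2l _ (ln1D_bound xs))) ?exprn_ge0//.
  have H := ler_wpM2l (mulr_ge0 (mulr_ge0 (ler0n R 2) B0) (ltW D0)) (Kq n).
  have n3 : 0 <= n%:R ^+ 3 :> R by rewrite exprn_ge0.
  have := ler_wpM2l n3 (xB n); lra.
Unshelve. all: by end_near. Qed.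

(** * Ratios of consecutive roots *)

Lemma real_rootE (R : realType) n (y : R) : 0 < y ->
  real_root n y = expR (ln y / n%:R).
Proof. by move=> y0; rewrite /real_root /powR gt_eqF// mulrC. Qed.

(** Only the asymptotics a n = l^n / D + O(r^n) matters here.  With
    b n = (e n - ln D) / n the root ratio is exp (b n - b (n-1)), so
    monotonicity is a statement on second differences of b, and the limit
    follows from b n --> 0. *)
Lemma root_ratio_asymptotics (R : realType) (a : nat -> R) (l r D B : R) :
  0 < r -> r < l -> 1 < D ->
  (forall n, `|a n - l ^+ n / D| <= B * r ^+ n) ->
  (exists N : nat, (2 <= N)%N /\
     forall n : nat, (N <= n)%N ->
       real_root n.-1 (a n.-1) != 0 /\ root_ratio a n.+1 < root_ratio a n)
  /\ root_ratio a @ \oo --> (1 : R).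
Proof.
move=> r0 rl D1 aB; have D0 : 0 < D by lra.
have [K [e [K0 [N _ HN]]]] := ln_asymptotics r0 rl D0 aB.
pose T := ln D; have T0 : 0 < T by rewrite ln_gt0.
pose b n := (e n - T) / n%:R.
have rootE n : (N < n)%N -> real_root n (a n) = expR (ln l + b n).
  move=> Nn; have /= [a0 aE _] := HN n (ltnW Nn).
  rewrite real_rootE// aE; congr expR; rewrite mulrDl -[ln l *+ n]mulr_natr mulfK//.
  by rewrite pnatr_eq0 -lt0n (leq_trans _ Nn).
have ratioE n : (N.+1 < n)%N -> root_ratio a n = expR (b n - b n.-1).
  case: n => // n Nn; rewrite /root_ratio !rootE//=; last exact: ltnW.
  by rewrite -expRN -expRD; congr expR; ring.
have b_small n : (N < n)%N -> `|b n| <= (K + T) / n%:R.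
  move=> Nn; have n0 : 0 < n%:R :> R by rewrite ltr0n (leq_trans _ Nn).
  rewrite normrM normfV (gtr0_norm n0) ler_wpM2r ?invr_ge0 ?(ltW n0)//.
  have /= [_ _ eK] := HN n (ltnW Nn).
  rewrite (le_trans (ler_normB _ _))// (gtr0_norm T0) lerD2r.
  apply: le_trans eK; rewrite ler_peMl// exprn_ege1//.
  by rewrite ler1n (leq_trans _ Nn).
split; last first.
  have b0 : b n @[n --> \oo] --> 0.
    rewrite -cvg_shiftS.
    apply: (@squeeze_cvgr _ _ _ _ (fun n => - ((K + T) * harmonic n))
                                  (fun n => (K + T) * harmonic n)).
    - exists N => // n /= Nn; rewrite -ler_norml; exact: b_small.
    - rewrite -oppr0 -(mulr0 (K + T)).
      by apply: cvgN; apply: cvgMr; exact: cvg_harmonic.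
    - by rewrite -(mulr0 (K + T)); apply: cvgMr; exact: cvg_harmonic.
  rewrite -cvg_shiftS -expR0.
  have : expR (b n.+1 - b n) @[n --> \oo] --> expR (0 - 0).
    apply: continuous_cvg; first exact: continuous_expR.
    by apply: cvgB => //; rewrite cvg_shiftS.
  rewrite subr0; apply: cvg_trans; apply: near_eq_cvg.
  by exists N.+1 => // n /= Nn; rewrite ratioE.
pose M := Num.truncn (9 * K / (2 * T)).
exists (maxn N M).+3; split=> // -[//|[//|n]]; rewrite 2!ltnS gtn_max.
move=> /andP[Nn Mn]; rewrite -pred_Sn; split.
  by rewrite rootE ?gt_eqF ?expR_gt0//; exact: ltn_trans (ltnSn _).
have N2 : (N.+1 < n.+2)%N := leqW Nn.
rewrite (ratioE _ N2) (ratioE _ (leqW N2)) ltr_expR /=.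
have /= [_ _ e0] := HN n.+1 (leqW (ltnW Nn)).
have /= [_ _ e1] := HN n.+2 (leqW (leqW (ltnW Nn))).
have /= [_ _ e2] := HN n.+3 (leqW (leqW (leqW (ltnW Nn)))).
have E1 : n.+2%:R = n.+1%:R + 1 :> R by rewrite -natr1.
have E2 : n.+3%:R = n.+1%:R + 2 :> R by rewrite -[RHS]natrD addn2.
rewrite /b E1 E2; rewrite E1 in e1; rewrite E2 in e2.
apply: (@second_difference_lt0 _ _ _ K); rewrite ?ler1n//.
have : 9 * K / (2 * T) < n.+1%:R.
  by rewrite (lt_le_trans (truncnS_gt _))// ler_nat ltnW.
by rewrite ltr_pdivrMr ?mulr_gt0// [ltRHS]mulrC.
Qed.

(** * Positivity of the dominant zero *)

Lemma real_multiple_geometric_eq0 (R : realType) (x p r K : R) :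
  0 <= x -> 0 < r -> r < p -> (forall n, x * p ^+ n <= K * r ^+ n) -> x = 0.
Proof.
move=> x0 r0 rp xK; have p0 := lt_trans r0 rp.
apply/eqP; rewrite eq_le x0 andbT.
have q1 : `|r / p| < 1.
  by rewrite gtr0_norm ?divr_gt0// ltr_pdivrMr// mul1r.
have lim0 : K * (r / p) ^+ n @[n --> \oo] --> K * 0.
  by apply: cvgMr; exact: cvg_expr.
rewrite mulr0 in lim0.
rewrite -(cvg_lim (@norm_hausdorff _ _) lim0); apply: limr_ge; first by apply/cvg_ex; exists 0.
by apply: nearW => n; rewrite expr_div_n mulrA ler_pdivlMr ?exprn_gt0.
Qed.

(** Since z^n is O(r^n)-close to a nonnegative number, it is O(r^n)-close to its
    own modulus |z|^n.  Comparing the exponents n and n + 1 yields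
    |z - |z| | |z|^n = O(r^n), which is only possible if z = |z|. *)
Lemma nonneg_geometric_base (R : realType) (u : nat -> R[i]) (z c r B : R[i]) :
  0 < c -> 0 < r -> r < `|z| -> (forall n, 0 <= u n) ->
  (forall n, `|u n - z ^+ n / c| <= B * r ^+ n) -> z = `|z|.
Proof.
move=> c0 r0 rz u0 uB; have z0 := lt_trans r0 rz.
have zn n : `|z ^+ n - `|z| ^+ n| <= (2 * B * c) * r ^+ n.
  have h1 : `|u n * c - z ^+ n| <= B * c * r ^+ n.
    have -> : u n * c - z ^+ n = (u n - z ^+ n / c) * c by field; rewrite gt_eqF.
    by rewrite normrM (gtr0_norm c0) mulrAC ler_wpM2r// ltW.
  have h2 : `|u n * c - `|z| ^+ n| <= B * c * r ^+ n.
    apply: le_trans h1; apply: le_trans (ler_dist_dist _ _).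
    by rewrite normrX (ger0_norm (mulr_ge0 (u0 n) (ltW c0))).
  have -> : z ^+ n - `|z| ^+ n = (u n * c - `|z| ^+ n) - (u n * c - z ^+ n) by ring.
  rewrite (le_trans (ler_normB _ _))// (le_trans (lerD h2 h1))//.
  by rewrite le_eqVlt; apply/orP; left; apply/eqP; ring.
pose K := 2 * B * c * (r + `|z|).
have zK n : `|z - `|z| | * `|z| ^+ n <= K * r ^+ n.
  rewrite -normrX mulrC -normrM.
  have -> : z ^+ n * (z - `|z|)
    = (z ^+ n.+1 - `|z| ^+ n.+1) - `|z| * (z ^+ n - `|z| ^+ n).
    by rewrite !exprS; ring.
  rewrite (le_trans (ler_normB _ _))// normrM normr_id.
  rewrite (le_trans (lerD (zn _) (ler_wpM2l (normr_ge0 _) (zn _))))//.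
  by rewrite /K exprS le_eqVlt; apply/orP; left; apply/eqP; ring.
have Kr : K \is Num.real.
  by have := zK 0%N; rewrite !expr0 !mulr1 => /(le_trans (normr_ge0 _))/ger0_real.
have /complex_realP[x xE] : `|z - `|z| | \is Num.real by exact: normr_real.
have /complex_realP[p pE] : `|z| \is Num.real by exact: normr_real.
have /complex_realP[s sE] := gtr0_real r0.
have /complex_realP[k kE] := Kr.
apply/eqP; rewrite -subr_eq0 -normr_eq0 xE (@real_multiple_geometric_eq0 _ x p s k)//.
- by rewrite -ler0c -xE normr_ge0.
- by rewrite -ltcR -sE.
- by rewrite -ltcR -sE -pE.
- move=> n; have := zK n.
  by rewrite xE pE sE kE -!rmorphXn -!rmorphM/= lecR.
Qed.

(** * The characteristic polynomial *)

Lemma map_linrec_poly (R : realType) k (alpha : nat -> R) :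
  map_poly (real_complex R) (linrec_poly k alpha)
  = 'X^k - \sum_(1 <= i < k.+1) (real_complex R (alpha i)) *: 'X^(k - i).
Proof.
rewrite /linrec_poly rmorphB/= map_polyXn rmorph_sum/=; congr (_ - _).
by apply: eq_bigr => i _; rewrite map_polyZ map_polyXn.
Qed.

Lemma size_linrec_poly (R : realType) k (alpha : nat -> R) :
  size (linrec_poly k alpha) = k.+1 /\ linrec_poly k alpha \is monic.
Proof.
have lt : (size (- \sum_(1 <= i < k.+1) alpha i *: 'X^(k - i) : {poly R}) <
           size ('X^k : {poly R}))%N.
  rewrite size_polyN size_polyXn ltnS big_nat.
  apply: (big_ind (fun p : {poly R} => size p <= k)%N).
  - by rewrite size_poly0.
  - by move=> p q hp hq; rewrite (leq_trans (size_polyD _ _))// geq_max hp.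
  - move=> i /andP[i1 ik]; rewrite (leq_trans (size_scale_leq _ _))//.
    by rewrite size_polyXn ltn_subrL i1 (leq_trans i1).
rewrite /linrec_poly size_polyDl// size_polyXn; split=> //.
by rewrite monicE lead_coefDl// lead_coefXn.
Qed.

Lemma shift_op_linrec (R : realType) k (alpha a : nat -> R) n :
  is_linrec k alpha a ->
  shift_op (fun m => real_complex R (a m)) n
    (map_poly (real_complex R) (linrec_poly k alpha)) = 0.
Proof.
move=> [_ _ arec]; rewrite map_linrec_poly linearB/= shift_opXn (linear_sum (shift_op _ _)).
rewrite arec ?leq_addl// rmorph_sum/=; apply/eqP; rewrite subr_eq0; apply/eqP.
apply: eq_big_nat => i /andP[_ ik].
by rewrite linearZ/= shift_opXn rmorphM/= addnBA.
Qed.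

Theorem theorem2p4 (R : realType) (k : nat) (alpha : nat -> R) (a : nat -> R)
    (lambda : R[i]) (hk : (2 <= k)%N) (halphak : alpha k != 0)
    (ha : is_linrec k alpha a) (ha_ge0 : forall n : nat, 0 <= a n)
    (hdom : dominant_zero (map_poly (real_complex R) (linrec_poly k alpha)) lambda)
    (hderiv : 1 < (map_poly (real_complex R) (linrec_poly k alpha))^`().[lambda]) :
  (exists N : nat, (2 <= N)%N /\
     forall n : nat, (N <= n)%N ->
       real_root n.-1 (a n.-1) != 0 /\ root_ratio a n.+1 < root_ratio a n)
  /\ root_ratio a @ \oo --> (1 : R).
Proof.
have [szf fmon] := size_linrec_poly k alpha.
have [root_l _ ldom] := hdom.
(* The constant term of the polynomial is - alpha k, so 0 is not a zero. *)
have l0 : 0 < `|lambda|.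
  rewrite normr_gt0; apply: contraTneq root_l => ->.
  rewrite rootE map_linrec_poly hornerD hornerN horner_sum (@big_nat_recr _ _ _ k 1 _ (ltnW hk))/=.
  rewrite subnn hornerZ !hornerXn expr0 mulr1 expr0n (gtn_eqF (ltnW hk)) sub0r.
  rewrite big_nat big1 => [|i /andP[_ ik]]; last first.
    by rewrite hornerZ hornerXn expr0n subn_eq0 leqNgt ik mulr0.
  by rewrite add0r oppr_eq0 fmorph_eq0.
have D0 := lt_trans ltr01 hderiv.
have [||||r [B [r0 rl aB]]] :=
  @simple_dominant_asymptotics _ (fun m => real_complex R (a m)) _ lambda
    _ root_l l0 (lt0r_neq0 D0) ldom.
- by rewrite map_monic.
- by move=> n; exact: shift_op_linrec.
- by move=> n; rewrite size_map_poly szf; case: ha => a0 _ _ /a0 ->.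
- by rewrite size_map_poly szf/=; case: ha => _ -> _.
have a0 n : 0 <= real_complex R (a n) by rewrite ler0c.
have lE := nonneg_geometric_base D0 r0 rl a0 aB.
have /complex_realP[l lr] : lambda \is Num.real by rewrite lE normr_real.
have /complex_realP[s sE] := gtr0_real r0.
have /complex_realP[D DE] := gtr0_real D0.
have Br : B \is Num.real.
  by have := aB 0%N; rewrite expr0 mulr1 => /(le_trans (normr_ge0 _))/ger0_real.
have /complex_realP[b bE] := Br.
apply: (@root_ratio_asymptotics R a l s D b).
- by rewrite -ltcR -sE.
- by rewrite -ltcR -sE -lr lE.
- by rewrite -ltcR -DE.
move=> n; have := aB n.
rewrite DE lr sE bE -!rmorphXn -fmorphV -!rmorphM -rmorphB normc_def/=.
by rewrite expr0n addr0 sqrtr_sqr lecR.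
Qed.
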